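(* For $X\in\mathbb{C}^{d\times d}$, the following are equivalent: (i) the Neumann series $\sum_{k=0}^\infty X^k$ is weakly Borel summable to $(I-X)^{-1}$; (ii) the Neumann series $\sum_{k=0}^\infty X^k$ is strongly Borel summable to $(I-X)^{-1}$; (iii) $\lambda(X)\subseteq\{z\in\mathbb{C}:\operatorname{Re}(z)<1\}$.
   Context: $\lambda(X)$ is the set of eigenvalues of $X$. A series of matrices is conventionally summable if its partial sums converge in any matrix norm. For a sequence $A_\bullet=(A_k)_{k=0}^\infty$ in $\mathbb{C}^{d\times d}$ with $S_n=\sum_{k=0}^nA_k$, put, for $x>0$, $$\mathscr{WB}(A_\bullet)(x)=\sum_{k=0}^\infty S_k\frac{x^k}{k!},\qquad\mathscr{SB}(A_\bullet)(x)=\sum_{k=0}^\infty A_k\frac{x^k}{k!}.$$ The series $\sum_{k=0}^\infty A_k$ is weakly Borel summable to $S$ if the series $e^{-x}\mathscr{WB}(A_\bullet)(x)$ is conventionally summable for all $x>0$ and $\lim_{x\to\infty}e^{-x}\mathscr{WB}(A_\bullet)(x)=S$. It is strongly Borel summable to $S$ if $\int_0^xe^{-t}\mathscr{SB}(A_\bullet)(t)\,dt$ is well defined, with the series $\mathscr{SB}(A_\bullet)$ conventionally summable, for all $x>0$, and $\int_0^\infty e^{-x}\mathscr{SB}(A_\bullet)(x)\,dx=\lim_{x\to\infty}\int_0^xe^{-t}\mathscr{SB}(A_\bullet)(t)\,dt=S$. The assertion that the series is summable to $(I-X)^{-1}$ is understood to include that $I-X$ is invertible. *)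

(* Defs.v *)
From HB Require Import structures.
From mathcomp Require Import all_boot all_order all_algebra.
From mathcomp Require Import complex.
From mathcomp Require Import all_classical all_reals all_analysis.

Set Implicit Arguments.
Unset Strict Implicit.
Unset Printing Implicit Defensive.

Import Order.TTheory GRing.Theory Num.Theory.
Import numFieldNormedType.Exports.

Local Open Scope classical_set_scope.
Local Open Scope ring_scope.
Local Open Scope complex_scope.

(* The topology on [R[i]] is the one of its modulus; matrices over [R[i]] then
   carry the topology of the entrywise sup norm, which in finite dimension is
   the topology of every matrix norm. *)
HB.instance Definition _ (R : realType) := NormedModule.copy R[i] R[i]^o.

Definition conventionally_summable (R : realType) (d : nat)
    (A : nat -> 'M[R[i]]_d) : Prop :=
  cvgn (series A).

Definition weak_borel_term (R : realType) (d : nat)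
    (A : nat -> 'M[R[i]]_d) (x : R) (k : nat) : 'M[R[i]]_d :=
  (x ^+ k / k`!%:R)%:C *: \sum_(0 <= j < k.+1) A j.

Definition weak_borel (R : realType) (d : nat)
    (A : nat -> 'M[R[i]]_d) (x : R) : 'M[R[i]]_d :=
  limn (series (weak_borel_term A x)).

Definition strong_borel_term (R : realType) (d : nat)
    (A : nat -> 'M[R[i]]_d) (x : R) (k : nat) : 'M[R[i]]_d :=
  (x ^+ k / k`!%:R)%:C *: A k.

Definition strong_borel (R : realType) (d : nat)
    (A : nat -> 'M[R[i]]_d) (x : R) : 'M[R[i]]_d :=
  limn (series (strong_borel_term A x)).

(* Matrix-valued integrals are taken entrywise, and on each entry separately
   in the real and imaginary parts. [Rintegral] has a junk value when the
   integrand is not integrable, hence the separate integrability predicate. *)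
Definition mx_integrable (R : realType) (d : nat)
    (D : set R) (f : R -> 'M[R[i]]_d) : Prop :=
  forall i j : 'I_d,
    lebesgue_measure.-integrable D (EFin \o (fun t => complex.Re (f t i j))) /\
    lebesgue_measure.-integrable D (EFin \o (fun t => complex.Im (f t i j))).

Definition mx_integral (R : realType) (d : nat)
    (D : set R) (f : R -> 'M[R[i]]_d) : 'M[R[i]]_d :=
  \matrix_(i < d, j < d)
    ((\int[lebesgue_measure]_(t in D) complex.Re (f t i j)) +i*
     (\int[lebesgue_measure]_(t in D) complex.Im (f t i j))).

Definition weakly_borel_summable (R : realType) (d : nat)
    (A : nat -> 'M[R[i]]_d) (S : 'M[R[i]]_d) : Prop :=
  (forall x : R, 0 < x ->
     conventionally_summable
       (fun k => (expR (- x))%:C *: weak_borel_term A x k)) /\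
  (expR (- x))%:C *: weak_borel A x @[x --> +oo%R] --> S.

Definition strongly_borel_summable (R : realType) (d : nat)
    (A : nat -> 'M[R[i]]_d) (S : 'M[R[i]]_d) : Prop :=
  let f := fun t : R => (expR (- t))%:C *: strong_borel A t in
  (forall x : R, 0 < x ->
     conventionally_summable (strong_borel_term A x) /\
     mx_integrable `[0, x] f) /\
  mx_integral `[0, x] f @[x --> +oo%R] --> S.

Definition spectrum (R : realType) (d : nat) (X : 'M[R[i]]_d) : set R[i] :=
  [set z | eigenvalue X z].

(* Main.v *)
Require Import Defs.
From HB Require Import structures.
From mathcomp Require Import all_boot all_order all_algebra.
From mathcomp Require Import complex.
From mathcomp Require Import all_classical all_reals all_analysis.
From mathcomp Require Import ring lra.

(** Write [K] for the inverse of [1 - X]. Both Borel transforms are exponential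
    generating functions, so everything is expressed with the damped matrix
    exponential [mxborel P X t = e^(-t) P e^(tX)].

    The partial sums of the Neumann series are [K - K X X^k], hence the weak
    means are [K - e^(-t) K X e^(tX)]. Since [K (1 - X) = 1], the function
    [- e^(-t) K e^(tX)] is a primitive of the integrand [e^(-t) e^(tX)] of the
    strong means, which are therefore [K - e^(-t) K e^(tX)]. Thus each kind of
    summability says that [mxborel Q X] vanishes at infinity, for [Q = - K X]
    and [Q = - K] respectively ([weakly_borel_summableP] and
    [strongly_borel_summableP]).

    If the spectrum lies in the half-plane [Re z < 1], then [mxborel P X]
    vanishes at infinity for every [P] ([spectrum_mxborel_cvg0]). By
    Cayley-Hamilton, [P] is killed by a product of factors [X - z] with [z] an
    eigenvalue. Removing one factor at a time, [g = mxborel P X] solves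
    [g' = (z - 1) g + h], where [h = mxborel (P (X - z)) X] tends to 0 by
    induction; as [Re (z - 1) < 0], an energy estimate on [|g|^2] shows that [g]
    tends to 0 too ([damped_oscillation_cvg0]).

    Conversely, let [v X = a v] with [v Q] nonzero. Then [v Q] is again an
    eigenvector for [a], because [Q] commutes with [X], and
    [g = v (mxborel Q X)] solves [g' = (a - 1) g] with [g(0) = v Q]. If
    [Re a >= 1], then [|g|^2] is nondecreasing, so that [g] cannot tend to 0
    ([eigenvector_cvg0]). For [Q = - K] the row [v Q] is never zero; for
    [Q = - K X] it is zero only when [a = 0], where [Re a < 1] is clear. *)

Set Implicit Arguments.
Unset Strict Implicit.
Unset Printing Implicit Defensive.

Import Order.TTheory GRing.Theory Num.Theory.
Import numFieldNormedType.Exports.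
Local Open Scope classical_set_scope.
Local Open Scope ring_scope.
Local Open Scope complex_scope.

(** * Convergence of complex matrices by coordinates *)

Lemma cvg_mxP (R : realType) (m n : nat) (T : Type) (F : set_system T)
    {FF : Filter F} (f : T -> 'M[R[i]]_(m, n)) (A : 'M[R[i]]_(m, n)) :
  f @ F --> A <-> forall i j, f t i j @[t --> F] --> (A i j : R[i]).
Proof.
split=> [fA i j|fA].
  apply: (@cvg_comp _ _ _ f (fun M : 'M[R[i]]_(m, n) => M i j) F (nbhs A) _ fA).
  exact: coord_continuous.
apply/cvg_mx_entourageP => E entE.
have : \forall t \near F, forall i j, E (A i j, f t i j).
  apply: filter_forall => i; apply: filter_forall => j.
  by have /cvg_app_entourageP := fA i j; apply.
by apply: filterS => t tE i j; rewrite inE; exact: tE.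
Qed.

Lemma normc_ge_ReIm (R : realType) (u : R[i]) :
  `|complex.Re u|%:C <= `|u| /\ `|complex.Im u|%:C <= `|u|.
Proof.
case: u => u v; rewrite normc_def !lecR /= -!sqrtr_sqr.
by split; rewrite ler_wsqrtr// ?lerDl ?lerDr sqr_ge0.
Qed.

Lemma cvg_complexP (R : realType) (T : Type) (F : set_system T)
    {FF : Filter F} (f : T -> R[i]) (a : R[i]) :
  f @ F --> a <->
  (complex.Re (f t) @[t --> F] --> complex.Re a) /\
  (complex.Im (f t) @[t --> F] --> complex.Im a).
Proof.
have norm_le (z : R[i]) : `|z| <= (`|complex.Re z| + `|complex.Im z|)%:C.
  case: z => u v; rewrite normc_def lecR /= -[leRHS]ger0_norm ?addr_ge0//.
  rewrite -sqrtr_sqr ler_wsqrtr// -[u ^+ 2]real_normK ?num_real//.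
  rewrite -[v ^+ 2]real_normK ?num_real// sqrrD lerD2r lerDl.
  by rewrite mulrn_wge0// mulr_ge0.
split=> [fa|[fr fi]].
  split; apply/cvgrPdist_lt => e e0; move/cvgrPdist_lt : fa => /(_ e%:C);
    rewrite ltcR => /(_ e0); apply: filterS => t.
    have [+ _] := normc_ge_ReIm (a - f t).
    by move=> /le_lt_trans h /h; rewrite raddfB ltcR.
  have [_ +] := normc_ge_ReIm (a - f t).
  by move=> /le_lt_trans h /h; rewrite raddfB ltcR.
(* A positive element of [R[i]] is a positive real. *)
apply/cvgrPdist_lt => -[e e']; rewrite ltcE /= => /andP[/eqP e'0 {}e0].
subst e'; have e20 : 0 < e / 2 by rewrite divr_gt0.
move/cvgrPdist_lt : fr => /(_ _ e20) fr; move/cvgrPdist_lt : fi => /(_ _ e20).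
apply: filterS2 fr => t; rewrite -!raddfB => ltr lti.
apply: (le_lt_trans (norm_le _)).
by rewrite -[_ +i* _]/(e%:C) ltcR [ltRHS]splitr ltrD.
Qed.

(** * Exponential generating functions and their Borel means *)

Section GeneratingFunction.
Variable R : realType.
Implicit Types (c : nat -> R) (x t : R).

(** This growth is what powers of a matrix have; it makes the exponential
    generating function entire, and it is stable under the shift, which is
    differentiation. *)
Definition geometric_growth c := exists C M, forall k, `|c k| <= C * M ^+ k.

Definition egf c x := limn (pseries (fun k => c k / k`!%:R) x).

Lemma geometric_growth_shift c :
  geometric_growth c -> geometric_growth (fun k => c k.+1).
Proof.
by move=> [C [M cM]]; exists (C * M), M => k; rewrite -mulrA -exprS.
Qed.

Lemma is_cvg_egf c x :
  geometric_growth c -> cvgn (pseries (fun k => c k / k`!%:R) x).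
Proof.
move=> [C [M cM]]; apply: normed_cvg.
have C0 : 0 <= C by have := cM 0%N; rewrite expr0 mulr1; exact: le_trans.
apply: (@series_le_cvg _ _ (C *: exp_coeff (`|M| * `|x|))) => [k|k|k|].
- exact: normr_ge0.
- by rewrite /= mulr_ge0// exp_coeff_ge0// mulr_ge0.
- rewrite [leRHS](_ : _ = C * (k`!%:R^-1 * (`|M| * `|x|) ^+ k)); last first.
    by rewrite exp_coeffE.
  rewrite /= !normrM normrX exprMn.
  rewrite (ger0_norm (_ : 0 <= k`!%:R^-1))// ?invr_ge0//.
  rewrite [leRHS](_ : _ = C * `|M| ^+ k * k`!%:R^-1 * `|x| ^+ k); last first.
    by rewrite /GRing.scale/=; ring.
  rewrite ler_wpM2r ?exprn_ge0// ler_wpM2r ?invr_ge0//.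
  by rewrite (le_trans (cM k))// ler_wpM2l// -normrX ler_norm.
- exact/is_cvg_seriesZ/is_cvg_series_exp_coeff.
Qed.

Lemma pseries_diffs_egf c :
  pseries_diffs (fun k => c k / k`!%:R) = (fun k => c k.+1 / k`!%:R).
Proof.
by apply/funext => k; rewrite /pseries_diffs factS natrM invfM mulrCA mulVKf.
Qed.

Lemma is_derive_egf c x : geometric_growth c ->
  is_derive x (1 : R) (egf c) (egf (fun k => c k.+1) x).
Proof.
move=> cg; have := @pseries_snd_diffs _ (fun k => c k / k`!%:R) (`|x| + 1) x.
rewrite pseries_diffs_egf (pseries_diffs_egf (fun k => c k.+1)); apply.
- exact: is_cvg_egf.
- exact/is_cvg_egf/geometric_growth_shift.
- apply: (is_cvg_egf (c := fun k => c k.+2)).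
  exact/(geometric_growth_shift (c := fun k => c k.+1))/geometric_growth_shift.
- by rewrite [ltRHS]ger0_norm ?addr_ge0// ltrDl.
Qed.

Lemma egf0 c : egf c 0 = c 0%N.
Proof.
apply/cvg_lim => //; rewrite -cvg_shiftS /=.
rewrite (_ : (fun _ => _) = cst (c 0%N)); first exact: cvg_cst.
apply/funext => n; rewrite /pseries /series /= big_nat_recl//= expr0 fact0.
by rewrite divr1 mulr1 big1 ?addr0// => k _; rewrite exprS mul0r mulr0.
Qed.

(** The Borel mean of [c]; the factor [expR (- t)] normalizes it, so that a
    constant sequence is its own mean. *)
Definition borel c t := expR (- t) * egf c t.

Lemma borel0 c : borel c 0 = c 0%N.
Proof. by rewrite /borel oppr0 expR0 mul1r egf0. Qed.

Lemma is_derive_expRM (a t : R) :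
  is_derive t (1 : R) (fun t => expR (a * t)) (a * expR (a * t)).
Proof.
rewrite mulrC; apply: (@is_derive1_comp _ expR ( *%R a)).
by apply: is_derive_eq; rewrite /GRing.scale/= mulr1.
Qed.

Lemma is_derive_borel c t : geometric_growth c ->
  is_derive t (1 : R) (borel c) (borel (fun k => c k.+1) t - borel c t).
Proof.
move=> cg; have dc := is_derive_egf t cg.
have dN : is_derive t (1 : R) (fun t => expR (- t)) (- expR (- t)).
  have := is_derive_expRM (-1) t; rewrite !mulN1r.
  by congr (is_derive _ _ _ _); apply/funext => u; rewrite mulN1r.
apply: (is_derive_eq (is_deriveM dN dc)).
by rewrite /borel /GRing.scale/=; ring.
Qed.

Lemma borel_lin (a b : R) c c' t : geometric_growth c -> geometric_growth c' ->
  borel (fun k => a * c k + b * c' k) t = a * borel c t + b * borel c' t.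
Proof.
move=> /(is_cvg_egf (x := t)) cg /(is_cvg_egf (x := t)) cg'.
rewrite /borel [egf (fun _ => _) t](_ : _ = a * egf c t + b * egf c' t).
  by ring.
rewrite /egf -[a * _]/(a *: _) -[b * limn _]/(b *: _).
rewrite -!lim_seriesZ// -lim_seriesD; [|exact: is_cvg_seriesZ..].
congr (limn (series _)); apply/funext => k /=.
apply: (@eq_trans _ _ (a * (c k / k`!%:R * t ^+ k) +
  b * (c' k / k`!%:R * t ^+ k))) => //.
by ring.
Qed.

End GeneratingFunction.

(** * Linear equations with damping *)

Section DampedEquation.
Variable R : realType.
Implicit Types (u du p q h : R -> R).

(** Once [h <= alpha * e / 2], the inequality says that
    [expR (alpha * t) * (u t - e / 2)] is nonincreasing, so that [u] exceeds
    [e / 2] by at most a multiple of [expR (- alpha * t)]. *)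
Lemma damped_inequality_cvg0 u du h (alpha : R) :
  0 < alpha ->
  (forall t, 0 <= u t) ->
  (forall t, is_derive t (1 : R) u (du t)) ->
  (forall t, du t <= - alpha * u t + h t) ->
  h t @[t --> +oo] --> 0 ->
  u t @[t --> +oo] --> 0.
Proof.
move=> alpha0 u0 u' du_le h0; apply/cvgrPdist_lt => e e0.
have /(cvgr_le _ h0)[T [_ hT]] : 0 < alpha * (e / 2).
  by rewrite mulr_gt0// divr_gt0.
pose v t := expR (alpha * t) * (u t - e / 2).
have v' t : is_derive t (1 : R) v
    (expR (alpha * t) * (alpha * (u t - e / 2) + du t)).
  have dE := is_derive_expRM alpha t.
  have dU : is_derive t (1 : R) (fun t => u t - e / 2) (du t).
    apply: (is_derive_eq (is_deriveB (u' t) (is_derive_cst (e / 2) t 1))).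
    by rewrite subr0.
  apply: (is_derive_eq (is_deriveM dE dU)).
  by rewrite /GRing.scale/=; ring.
have v_le t : T + 1 <= t -> v t <= v (T + 1).
  move=> Tt; apply: (@ler0_derive1_nincry _ v (T + 1)) => //.
  - move=> x; rewrite in_itv/= andbT => Tx.
    rewrite derive1E derive_val pmulr_rle0 ?expR_gt0//.
    have /= := hT x (lt_trans _ Tx); rewrite ltrDl => /(_ ltr01) hx.
    by have := du_le x; lra.
  - by apply: derivable_within_continuous => x _; have [] := v' x.
have Et : expR (- (alpha * t)) * v (T + 1) @[t --> +oo] --> 0.
  rewrite -(mul0r (v (T + 1))); apply: cvgMr_tmp.
  apply: (@cvg_comp _ _ _ (fun t => alpha * t) (fun t => expR (- t)));
    last exact: cvgr_expR.
  exact/gt0_cvgMry.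
have e2 : 0 < e / 2 by rewrite divr_gt0.
have /(cvgr_lt _ Et) Ee := e2.
near=> t.
have Evt : expR (- (alpha * t)) * v (T + 1) < e / 2 by near: t.
have vt : v t <= v (T + 1).
  by apply: v_le; near: t; apply: nbhs_pinfty_ge; exact: num_real.
rewrite sub0r normrN ger0_norm//.
suff : u t - e / 2 < e / 2 by lra.
apply: le_lt_trans Evt; rewrite (_ : u t - e / 2 = expR (- (alpha * t)) * v t).
  by rewrite ler_wpM2l ?expR_ge0.
by rewrite /v mulrA -expRD addNr expR0 mul1r.
Unshelve. all: by end_near. Qed.

Lemma is_derive_sumsqr p q (p' q' t : R) :
  is_derive t (1 : R) p p' -> is_derive t (1 : R) q q' ->
  is_derive t (1 : R) (fun t => p t ^+ 2 + q t ^+ 2)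
    (2 * (p t * p' + q t * q')).
Proof.
move=> dp dq.
apply: (is_derive_eq (is_deriveD (is_deriveM dp dp) (is_deriveM dq dq))).
by rewrite /GRing.scale/=; ring.
Qed.

Lemma sumsqr_cvg0 p q :
  p t ^+ 2 + q t ^+ 2 @[t --> +oo] --> 0 -> p t @[t --> +oo] --> 0.
Proof.
move=> pq0; apply/cvgrPdist_lt => e e0.
have /(cvgr_lt _ pq0) := exprn_gt0 2 e0; apply: filterS => t pqe.
rewrite sub0r normrN -(ltr_pXn2r (_ : 0 < 2)%N) ?nnegrE ?normr_ge0 ?(ltW e0)//.
by rewrite real_normK ?num_real// (le_lt_trans _ pqe)// lerDl sqr_ge0.
Qed.

(** With [g = p + i q], this is [g' = (a + i b) g + (h + i k)]. The rotation [b]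
    leaves the energy [|g|^2] unchanged, and half of the damping [a] absorbs the
    forcing term. *)
Lemma damped_oscillation_cvg0 p q h k (a b : R) :
  a < 0 ->
  (forall t, is_derive t (1 : R) p (a * p t - b * q t + h t)) ->
  (forall t, is_derive t (1 : R) q (a * q t + b * p t + k t)) ->
  h t @[t --> +oo] --> 0 -> k t @[t --> +oo] --> 0 ->
  p t @[t --> +oo] --> 0 /\ q t @[t --> +oo] --> 0.
Proof.
move=> a0 p' q' h0 k0.
suff pq0 : p t ^+ 2 + q t ^+ 2 @[t --> +oo] --> 0.
  split; first exact: sumsqr_cvg0 pq0.
  by apply: (@sumsqr_cvg0 q p); under eq_fun do rewrite addrC.
apply: (@damped_inequality_cvg0 _ _
  (fun t => (h t * h t + k t * k t) / - a) (- a) _ _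
  (fun t => is_derive_sumsqr (p' t) (q' t))).
- by rewrite oppr_gt0.
- by move=> t; rewrite addr_ge0 ?sqr_ge0.
- move=> t; have hka : h t * h t + k t * k t =
      (h t * h t + k t * k t) / - a * - a.
    by rewrite divfK// oppr_eq0 lt_eqF.
  set H := _ / _ in hka *; rewrite -(ler_pM2r (_ : 0 < - a)) ?oppr_gt0//.
  rewrite [leRHS]mulrDl -hka opprK.
  (* The difference of the two sides is the sum of these squares. *)
  have := sqr_ge0 (a * p t + h t); have := sqr_ge0 (a * q t + k t).
  nra.
- have hk0 : h t * h t + k t * k t @[t --> +oo] --> (0 * 0 + 0 * 0 : R).
    by apply: cvgD; exact: cvgM.
  by rewrite -(mul0r (- a)^-1); apply: cvgMr_tmp; rewrite mulr0 addr0 in hk0.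
Qed.

End DampedEquation.

(** * Damped exponentials of complex matrices *)

Section ComplexBorel.
Variable R : realType.
Implicit Types (z w : nat -> R[i]) (t : R).

Lemma geometric_growth_lin (a b : R) (c c' : nat -> R) :
  geometric_growth c -> geometric_growth c' ->
  geometric_growth (fun k => a * c k + b * c' k).
Proof.
move=> [C [M cM]] [C' [M' cM']].
exists (`|a| * `|C| + `|b| * `|C'|), (`|M| + `|M'|) => k.
rewrite mulrDl (le_trans (ler_normD _ _))// !normrM lerD// -mulrA ler_wpM2l//.
- rewrite (le_trans (cM k))// (le_trans (ler_norm _))// normrM normrX.
  by rewrite ler_wpM2l// lerXn2r ?nnegrE ?addr_ge0// lerDl.
- rewrite (le_trans (cM' k))// (le_trans (ler_norm _))// normrM normrX.
  by rewrite ler_wpM2l// lerXn2r ?nnegrE ?addr_ge0// lerDr.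
Qed.

Definition cgeometric_growth z :=
  geometric_growth (fun k => complex.Re (z k)) /\
  geometric_growth (fun k => complex.Im (z k)).

Definition cborel z t : R[i] :=
  borel (fun k => complex.Re (z k)) t +i* borel (fun k => complex.Im (z k)) t.

(** The factors 1 give the right-hand sides of [Re_lin] and [Im_lin] the shape
    of nested real linear combinations, to which [borel_lin] applies. *)
Lemma Re_lin (a b u v : R[i]) : complex.Re (a * u + b * v) =
  1 * (complex.Re a * complex.Re u + - complex.Im a * complex.Im u) +
  1 * (complex.Re b * complex.Re v + - complex.Im b * complex.Im v).
Proof. by case: a b u v => [? ?] [? ?] [? ?] [? ?] /=; ring. Qed.

Lemma Im_lin (a b u v : R[i]) : complex.Im (a * u + b * v) =
  1 * (complex.Re a * complex.Im u + complex.Im a * complex.Re u) +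
  1 * (complex.Re b * complex.Im v + complex.Im b * complex.Re v).
Proof. by case: a b u v => [? ?] [? ?] [? ?] [? ?] /=; ring. Qed.

Lemma cgeometric_growth_lin (a b : R[i]) z w :
  cgeometric_growth z -> cgeometric_growth w ->
  cgeometric_growth (fun k => a * z k + b * w k).
Proof.
move=> [zr zi] [wr wi]; split.
- under eq_fun do rewrite Re_lin.
  by apply: geometric_growth_lin; exact: geometric_growth_lin.
- under eq_fun do rewrite Im_lin.
  by apply: geometric_growth_lin; exact: geometric_growth_lin.
Qed.

Lemma cborel_lin (a b : R[i]) z w t :
  cgeometric_growth z -> cgeometric_growth w ->
  cborel (fun k => a * z k + b * w k) t = a * cborel z t + b * cborel w t.
Proof.
move=> [zr zi] [wr wi]; apply/eqP; rewrite eq_complex Re_lin Im_lin /cborel /=.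
under [X in borel X]eq_fun do rewrite Re_lin.
under [X in _ && (borel X _ == _)]eq_fun do rewrite Im_lin.
by rewrite !borel_lin ?eqxx//; exact: geometric_growth_lin.
Qed.

Lemma cborel_sum (I : Type) (s : seq I) (a : I -> R[i])
    (z : I -> nat -> R[i]) t :
  (forall l, cgeometric_growth (z l)) ->
  cgeometric_growth (fun k => \sum_(l <- s) a l * z l k) /\
  cborel (fun k => \sum_(l <- s) a l * z l k) t =
    \sum_(l <- s) a l * cborel (z l) t.
Proof.
move=> zg; elim: s => [|l s [sg sE]].
  have g0 : geometric_growth (fun _ : nat => 0 : R).
    by exists 0, 0 => k; rewrite normr0 mul0r.
  have zg0 : cgeometric_growth (fun=> 0) by split.
  under eq_fun do rewrite big_nil; rewrite big_nil; split=> //.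
  have := cborel_lin 0 0 t zg0 zg0; rewrite !mul0r addr0 => {2}<-.
  by congr cborel; apply/funext => k; rewrite mul0r addr0.
under eq_fun do rewrite big_cons -[\sum_(_ <- _) _]mul1r.
rewrite big_cons -sE -[X in _ = _ + X]mul1r -cborel_lin//; split=> //.
exact: cgeometric_growth_lin.
Qed.

Lemma cgeometric_growth_bound z (C M : R[i]) : 0 <= C -> 0 <= M ->
  (forall k, `|z k| <= C * M ^+ k) -> cgeometric_growth z.
Proof.
move=> C0 M0 zCM; split; exists (complex.Re C), (complex.Re M) => k;
  rewrite -lecR rmorphM rmorphXn /= !RRe_real ?ger0_real//;
  apply: le_trans (zCM k); by have [] := normc_ge_ReIm (z k).
Qed.

End ComplexBorel.

Section MatrixBorel.
Variables (R : realType) (d : nat).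
Implicit Types (X : 'M[R[i]]_d) (t : R).

(** The matrix [e^(-t) P e^(tX)]. *)
Definition mxborel m (P : 'M[R[i]]_(m, d)) X t : 'M[R[i]]_(m, d) :=
  \matrix_(i, j) cborel (fun k => (P *m X ^+ k) i j) t.

Lemma mulmx_exprS m (P : 'M[R[i]]_(m, d)) X k :
  P *m X ^+ k.+1 = P *m X *m X ^+ k.
Proof. by rewrite -mulmxA exprS. Qed.

Lemma mulmx_exprSr m (P : 'M[R[i]]_(m, d)) X k :
  P *m X ^+ k.+1 = P *m X ^+ k *m X.
Proof. by rewrite -mulmxA exprSr. Qed.

(** The sum of the moduli of the entries is a submultiplicative norm, which
    bounds every entry. *)
Lemma cgeometric_growth_mx m (P : 'M[R[i]]_(m, d)) X i j :
  cgeometric_growth (fun k => (P *m X ^+ k) i j).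
Proof.
pose N m' n' (A : 'M[R[i]]_(m', n')) := \sum_i \sum_j `|A i j|.
have N0 m' n' (A : 'M[R[i]]_(m', n')) : 0 <= N _ _ A.
  by do 2 (apply: sumr_ge0 => ? _).
apply: (@cgeometric_growth_bound _ _ (N _ _ P) (N _ _ X)) => // k.
elim: k j => [|k IH] j.
  rewrite expr0 mulmx1 mulr1 /N (bigD1 i)//= (bigD1 j)//= -addrA lerDl.
  by rewrite addr_ge0//; do ?[apply: sumr_ge0 => ? _].
rewrite mulmx_exprSr mxE (le_trans (ler_norm_sum _ _ _))//.
rewrite exprSr mulrA [X in _ <= _ * X]/N mulr_sumr ler_sum// => l _.
rewrite normrM ler_pM//= (bigD1 j)//= lerDl.
by apply: sumr_ge0.
Qed.
Hint Resolve cgeometric_growth_mx : core.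

Lemma mxborel0 m (P : 'M[R[i]]_(m, d)) X : mxborel P X 0 = P.
Proof.
apply/matrixP => i j; rewrite mxE /cborel !borel0 expr0 mulmx1.
by case: (P i j).
Qed.

Lemma mxborel1 m (P : 'M[R[i]]_(m, d)) t : mxborel P 1%:M t = P.
Proof.
have borelC (c : R) : borel (fun=> c) t = c.
  rewrite /borel (_ : egf _ _ = c * expR t).
    by rewrite mulrCA -expRD addNr expR0 mulr1.
  rewrite /egf (_ : pseries _ t = series (c *: exp_coeff t)).
    exact: lim_seriesZ (is_cvg_series_exp_coeff t).
  congr series; apply/funext => k.
  by rewrite [RHS]/(c * exp_coeff t k) exp_coeffE; exact/esym/mulrA.
apply/matrixP => i j; rewrite mxE /cborel.
under [X in borel X]eq_fun do rewrite expr1n mulmx1.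
under [X in _ +i* borel X _]eq_fun do rewrite expr1n mulmx1.
by rewrite !borelC; case: (P i j).
Qed.

(** Left multiplication acts on entries by complex linear combinations, which
    [cborel] respects. *)
Lemma mulmx_mxborel m n (Q : 'M[R[i]]_(n, m)) (P : 'M[R[i]]_(m, d)) X t :
  Q *m mxborel P X t = mxborel (Q *m P) X t.
Proof.
apply/matrixP => i j; rewrite !mxE.
under [X in cborel X]eq_fun do rewrite -mulmxA mxE.
under eq_bigr do rewrite mxE.
by rewrite (cborel_sum _ (Q i) t (fun l => cgeometric_growth_mx P X l j)).2.
Qed.

Lemma mxborelD m (P Q : 'M[R[i]]_(m, d)) X t (a : R[i]) :
  mxborel (a *: P + Q) X t = a *: mxborel P X t + mxborel Q X t.
Proof.
apply/matrixP => i j; rewrite !mxE -[X in _ = _ + X]mul1r -cborel_lin//.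
by congr cborel; apply/funext => k; rewrite mulmxDl -scalemxAl !mxE mul1r.
Qed.

Lemma mxborelZ m (a : R[i]) (P : 'M[R[i]]_(m, d)) X t :
  mxborel (a *: P) X t = a *: mxborel P X t.
Proof. by rewrite -!mul_scalar_mx mulmx_mxborel. Qed.

(** The shift of the coefficients [P X^k] multiplies [P] by [X] on the right,
    and the derivative of a Borel mean is the mean of the shift minus the mean. *)
Lemma is_derive_mxborel m (P : 'M[R[i]]_(m, d)) X t i j :
  is_derive t (1 : R) (fun u => complex.Re (mxborel P X u i j))
    (complex.Re (mxborel (P *m (X - 1%:M)) X t i j)) /\
  is_derive t (1 : R) (fun u => complex.Im (mxborel P X u i j))
    (complex.Im (mxborel (P *m (X - 1%:M)) X t i j)).
Proof.
have -> : mxborel (P *m (X - 1%:M)) X t = mxborel (P *m X) X t - mxborel P X t.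
  rewrite mulmxBr mulmx1 addrC -scaleN1r mxborelD.
  by rewrite scaleN1r addrC.
have [gr gi] := cgeometric_growth_mx P X i j.
split; under eq_fun do rewrite mxE /=.
  apply: (is_derive_eq (is_derive_borel t gr)); rewrite !mxE /=.
  by congr (borel _ _ - _); apply/funext => k; rewrite mulmx_exprS.
apply: (is_derive_eq (is_derive_borel t gi)); rewrite !mxE /=.
by congr (borel _ _ - _); apply/funext => k; rewrite mulmx_exprS.
Qed.

End MatrixBorel.

Section MatrixDecay.
Variables (R : realType) (d : nat).
Implicit Types (X : 'M[R[i]]_d) (t : R).

Lemma cvg_mulmx0 m n (Q : 'M[R[i]]_(m, n)) (f : R -> 'M[R[i]]_(n, d)) :
  f t @[t --> +oo] --> (0 : 'M[R[i]]_(n, d)) ->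
  Q *m f t @[t --> +oo] --> (0 : 'M[R[i]]_(m, d)).
Proof.
move=> /cvg_mxP f0; apply/cvg_mxP => i j.
under eq_fun do rewrite mxE.
rewrite mxE; elim: index_enum => [|l s IH].
  by under eq_fun do rewrite big_nil; exact: cvg_cst.
under eq_fun do rewrite big_cons.
have : Q i l * f t l j @[t --> +oo] -->
      (Q i l * (0 : 'M[R[i]]_(n, d)) l j).
  by apply: cvgMl_tmp; exact: f0.
by rewrite mxE mulr0 => /cvgD/(_ IH); rewrite addr0.
Qed.

Lemma cvg_exp_series m (P : 'M[R[i]]_(m, d)) X t :
  series (fun k => (t ^+ k / k`!%:R)%:C *: (P *m X ^+ k)) @ \oo -->
  (expR t)%:C *: mxborel P X t.
Proof.
apply/cvg_mxP => i j; apply/cvg_complexP.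
have ReZ (a : R) (u : R[i]) : complex.Re (a%:C * u) = a * complex.Re u.
  by case: u => u v /=; rewrite mul0r subr0.
have ImZ (a : R) (u : R[i]) : complex.Im (a%:C * u) = a * complex.Im u.
  by case: u => u v /=; rewrite mul0r addr0.
have [gr gi] := cgeometric_growth_mx P X i j.
have eB c : expR t * borel c t = egf c t.
  by rewrite /borel mulrA -expRD subrr expR0 mul1r.
rewrite !mxE ReZ ImZ /= !eB; split.
- rewrite [X in X @ _](_ : _ =
    pseries (fun k => complex.Re ((P *m X ^+ k) i j) / k`!%:R) t).
    exact: (is_cvg_egf (x := t) gr).
  apply/funext => n.
  rewrite /pseries /series /= summxE raddf_sum; apply: eq_bigr => k _.
  by rewrite mxE; apply: (etrans (ReZ _ _)); ring.
- rewrite [X in X @ _](_ : _ =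
    pseries (fun k => complex.Im ((P *m X ^+ k) i j) / k`!%:R) t).
    exact: (is_cvg_egf (x := t) gi).
  apply/funext => n.
  rewrite /pseries /series /= summxE raddf_sum; apply: eq_bigr => k _.
  by rewrite mxE; apply: (etrans (ImZ _ _)); ring.
Qed.

(** * Decay of the damped exponential and the spectrum *)

(** Induction on the number of factors: with [z] the first of them, an entry of
    [g = mxborel P X] solves [g' = (z - 1) g + h], where the forcing term [h]
    comes from [P (X - z)], which one factor fewer annihilates. *)
Lemma mxborel_annihilated_cvg0 m (P : 'M[R[i]]_(m, d)) X (s : seq R[i]) :
  (forall z, z \in s -> complex.Re z < 1) ->
  P *m \prod_(z <- s) (X - z%:M) = 0 ->
  mxborel P X t @[t --> +oo] --> (0 : 'M[R[i]]_(m, d)).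
Proof.
elim: s P => [|z s IH] P sP.
  rewrite big_nil mulmx1 => ->.
  under eq_fun do rewrite -(scale0r 0) mxborelZ scale0r.
  exact: cvg_cst.
rewrite big_cons mulmxA => /IH {}IH.
have /IH/cvg_mxP P'0 : forall z, z \in s -> complex.Re z < 1.
  by move=> y ys; apply: sP; rewrite inE ys orbT.
have {sP} z1 : complex.Re (z - 1) < 0 by rewrite raddfB subr_lt0 sP// mem_head.
have PX : P *m (X - 1%:M) = (z - 1) *: P + P *m (X - z%:M).
  rewrite !mulmxBr mulmx1 mul_mx_scalar scalerBl scale1r.
  by rewrite [RHS]addrC addrA subrK.
apply/cvg_mxP => i j; apply/cvg_complexP; rewrite mxE.
have := P'0 i j; rewrite mxE => /cvg_complexP[h0 k0].
apply: (damped_oscillation_cvg0 (b := complex.Im (z - 1)) z1 _ _ h0 k0) => t.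
- have [+ _] := is_derive_mxborel P X t i j.
  rewrite PX mxborelD => /is_derive_eq; apply.
  move: (mxborel P X t) (mxborel (P *m (X - z%:M)) X t) => A B.
  by rewrite !mxE; case: (z - 1) (A i j) (B i j) => [? ?] [? ?] [? ?] /=; ring.
- have [_ +] := is_derive_mxborel P X t i j.
  rewrite PX mxborelD => /is_derive_eq; apply.
  move: (mxborel P X t) (mxborel (P *m (X - z%:M)) X t) => A B.
  by rewrite !mxE; case: (z - 1) (A i j) (B i j) => [? ?] [? ?] [? ?] /=; ring.
Qed.

(** Some coordinate [g] of [mxborel v X] solves [g' = (a - 1) g] with
    [g(0) <> 0], so that [|g|^2] has derivative [2 (Re a - 1) |g|^2]. *)
Lemma eigenvector_cvg0 (v : 'rV[R[i]]_d) X (a : R[i]) :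
  v *m X = a *: v -> v != 0 ->
  mxborel v X t @[t --> +oo] --> (0 : 'rV[R[i]]_d) -> complex.Re a < 1.
Proof.
move=> vX v0 /cvg_mxP vX0; rewrite ltNge; apply/negP => a1.
have [j vj] : exists j, v 0 j != 0.
  apply/existsP; apply: contraNT v0; rewrite negb_exists => /forallP v0.
  by apply/eqP/rowP => j; rewrite mxE; apply/eqP; rewrite -[_ == _]negbK v0.
have vX1 : v *m (X - 1%:M) = (a - 1) *: v.
  by rewrite mulmxBr mulmx1 vX scalerBl scale1r.
have := vX0 0 j; rewrite mxE => /cvg_complexP[/= p0 q0].
pose p t := complex.Re (mxborel v X t 0 j).
pose q t := complex.Im (mxborel v X t 0 j).
have u' t : is_derive t (1 : R) (fun t => p t ^+ 2 + q t ^+ 2)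
    (2 * (complex.Re a - 1) * (p t ^+ 2 + q t ^+ 2)).
  have [dp dq] := is_derive_mxborel v X t 0 j.
  apply: (is_derive_eq (is_derive_sumsqr dp dq)).
  rewrite vX1 mxborelZ /p /q; move: (mxborel v X t) => B; rewrite mxE.
  by case: a (B 0 j) {vX vX1 a1} => [? ?] [? ?] /=; ring.
have u_ge t : 0 <= t -> p 0 ^+ 2 + q 0 ^+ 2 <= p t ^+ 2 + q t ^+ 2.
  move=> t0.
  apply: (@ger0_derive1_ndecry _ (fun t => p t ^+ 2 + q t ^+ 2) 0) => //.
  - move=> x _; rewrite derive1E derive_val.
    by rewrite !mulr_ge0 ?subr_ge0// addr_ge0 ?sqr_ge0.
  - by apply: derivable_within_continuous => x _; have [] := u' x.
have u0 : 0 < p 0 ^+ 2 + q 0 ^+ 2.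
  rewrite /p /q mxborel0; move: vj; case: (v 0 j) => x y; rewrite eq_complex /=.
  rewrite negb_and lt_def paddr_eq0 ?sqr_ge0// !sqrf_eq0 negb_and.
  by rewrite addr_ge0 ?sqr_ge0// andbT.
have pq0 : p t * p t + q t * q t @[t --> +oo] -->
    (0 * 0 + 0 * 0 : R).
  by apply: cvgD; exact: cvgM.
rewrite mulr0 addr0 in pq0.
have /(cvgr_lt _ pq0) ut := u0.
have t_ge0 : \forall t \near +oo, 0 <= t :> R.
  by apply: nbhs_pinfty_ge; exact: num_real.
have [t [/= + t0]] := filter_ex (filterI ut t_ge0).
by rewrite -!expr2 ltNge u_ge.
Qed.

(** As [Q] commutes with [X], the row [v Q] is again an eigenvector for [a]. *)
Lemma commuting_cvg0_eigenvalue (Q X : 'M[R[i]]_d) (v : 'rV[R[i]]_d)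
    (a : R[i]) :
  v *m X = a *: v -> Q *m X = X *m Q -> v *m Q != 0 ->
  mxborel Q X t @[t --> +oo] --> (0 : 'M[R[i]]_d) -> complex.Re a < 1.
Proof.
move=> vX QX vQ0 Q0; apply: (eigenvector_cvg0 _ vQ0 (X := X)).
  by rewrite -mulmxA QX mulmxA vX -scalemxAl.
by have := @cvg_mulmx0 _ _ v _ Q0; under eq_fun do rewrite mulmx_mxborel.
Qed.

End MatrixDecay.

Lemma spectrum_mxborel_cvg0 (R : realType) (d m : nat) (P : 'M[R[i]]_(m, d))
    (X : 'M[R[i]]_d) :
  spectrum X `<=` [set z : R[i] | complex.Re z < 1] ->
  mxborel P X t @[t --> +oo] --> (0 : 'M[R[i]]_(m, d)).
Proof.
case: d P X => [|d'] P X sX; first by apply/cvg_mxP => i [].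
have [s Es] := closed_field_poly_normal (char_poly X).
rewrite (monicP (char_poly_monic X)) scale1r in Es.
apply: (mxborel_annihilated_cvg0 (s := s)).
  move=> z zs; apply: sX; rewrite /spectrum /= eigenvalue_root_char Es.
  by rewrite root_prod_XsubC.
have := Cayley_Hamilton X; rewrite Es rmorph_prod /=.
under eq_bigr do rewrite rmorphB /= horner_mx_X horner_mx_C.
by move=> ->; rewrite mulmx0.
Qed.

(** * Integration of a derivative *)

Section Primitive.
Variable R : realType.
Implicit Types f F : R -> R.

Lemma is_derive_continuous F f :
  (forall t, is_derive t (1 : R) F (f t)) -> continuous F.
Proof.
move=> dF t; apply: differentiable_continuous; apply/derivable1_diffP.
by have [] := dF t.
Qed.

Lemma integral_is_derive x f F : 0 < x ->
  (forall t, is_derive t (1 : R) F (f t)) -> continuous f ->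
  lebesgue_measure.-integrable `[0, x] (EFin \o f) /\
  \int[lebesgue_measure]_(t in `[0, x]) f t = F x - F 0.
Proof.
move=> x0 dF cf.
have cf' : {within `[0, x], continuous f} by exact: continuous_subspaceT.
split.
  by apply: continuous_compact_integrable => //; exact: segment_compact.
have cF := is_derive_continuous dF.
rewrite /Rintegral (continuous_FTC2 x0 cf' (F := F)) //.
- split; first by move=> t _; have [] := dF t.
  + exact/cvg_at_right_filter/cF.
  + exact/cvg_at_left_filter/cF.
- by move=> t _; have dFt := dF t; rewrite derive1E derive_val.
Qed.

End Primitive.

(** * The Borel means of the Neumann series *)

Section BorelSums.
Variables (R : realType) (d : nat) (X : 'M[R[i]]_d).
Hypothesis X1 : 1%:M - X \in unitmx.
Let K := invmx (1%:M - X).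

Lemma resolvent_comm : K *m X = X *m K.
Proof.
have -> : X = 1%:M - (1%:M - X) by rewrite opprB addrC subrK.
by rewrite mulmxBr mulmxBl mulmx1 mul1mx mulVmx// mulmxV.
Qed.

Lemma partial_neumann_sum k :
  \sum_(0 <= j < k.+1) X ^+ j = (- (K *m X)) *m X ^+ k + K.
Proof.
have KX : K - K *m X = 1%:M by rewrite -{1}(mulmx1 K) -mulmxBr mulVmx.
elim: k => [|k IH].
  by rewrite big_nat1 expr0 mulmx1 addrC KX.
have XX : X *m X ^+ k = X ^+ k.+1 by rewrite exprS.
rewrite big_nat_recr//= IH -[X ^+ k.+1 in LHS]mul1mx -KX mulmxBl !mulNmx.
by rewrite -[K *m X *m X ^+ k]mulmxA XX addrACA addNr add0r addrC.
Qed.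

Lemma cvg_weak_borel_series x :
  series (weak_borel_term (fun k => X ^+ k) x) @ \oo -->
  (expR x)%:C *: (mxborel (- (K *m X)) X x + K).
Proof.
have -> : weak_borel_term (fun k => X ^+ k) x =
    (fun k => (x ^+ k / k`!%:R)%:C *: (- (K *m X) *m X ^+ k)) +
    (fun k => (x ^+ k / k`!%:R)%:C *: (K *m 1%:M ^+ k)).
  apply/funext => k; rewrite /weak_borel_term partial_neumann_sum scalerDr.
  by rewrite [RHS]/(_ + _) expr1n mulmx1.
rewrite seriesD scalerDr; apply: cvgD; first exact: cvg_exp_series.
by have := @cvg_exp_series R d d K 1%:M x; rewrite mxborel1.
Qed.

Lemma cvg_strong_borel_series x :
  series (strong_borel_term (fun k => X ^+ k) x) @ \oo -->
  (expR x)%:C *: mxborel 1%:M X x.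
Proof.
have := @cvg_exp_series R d d 1%:M X x.
by under [X in series X]eq_fun do rewrite mul1mx.
Qed.

Lemma expRN_scale x (A : 'M[R[i]]_d) :
  (expR (- x))%:C *: ((expR x)%:C *: A) = A.
Proof. by rewrite scalerA -rmorphM -expRD addNr expR0 scale1r. Qed.

Lemma damped_weak_borel x :
  (expR (- x))%:C *: weak_borel (fun k => X ^+ k) x =
  mxborel (- (K *m X)) X x + K.
Proof.
have E := cvg_lim (@norm_hausdorff _ _) (@cvg_weak_borel_series x).
by rewrite /weak_borel E expRN_scale.
Qed.

Lemma damped_strong_borel x :
  (expR (- x))%:C *: strong_borel (fun k => X ^+ k) x = mxborel 1%:M X x.
Proof.
have E := cvg_lim (@norm_hausdorff _ _) (@cvg_strong_borel_series x).
by rewrite /strong_borel E expRN_scale.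
Qed.

(** As [- K (X - 1) = 1], the function [mxborel (- K) X] is a primitive of
    [mxborel 1 X]; its value at 0 is [- K]. *)
Lemma mx_integral_damped_exp x : 0 < x ->
  mx_integrable `[0, x] (mxborel 1%:M X) /\
  mx_integral `[0, x] (mxborel 1%:M X) = mxborel (- K) X x + K.
Proof.
move=> x0.
have K1 : - K *m (X - 1%:M) = 1%:M by rewrite mulNmx -mulmxN opprB mulVmx.
have dK1 t i j := is_derive_mxborel (- K *m (X - 1%:M)) X t i j.
have re i j := integral_is_derive x0
  (fun t => (is_derive_mxborel (- K) X t i j).1)
  (is_derive_continuous (fun t => (dK1 t i j).1)).
have im i j := integral_is_derive x0
  (fun t => (is_derive_mxborel (- K) X t i j).2)
  (is_derive_continuous (fun t => (dK1 t i j).2)).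
rewrite K1 in re im; split.
  by move=> i j; split; [have [] := re i j|have [] := im i j].
apply/matrixP => i j; rewrite mxE (re i j).2 (im i j).2 !mxborel0.
move: (mxborel (- K) X x) => B; rewrite !mxE.
by case: (B i j) (K i j) => [? ?] [? ?]; rewrite /= !opprK.
Qed.

Lemma cvg_add_resolvent (f : R -> 'M[R[i]]_d) :
  f t + K @[t --> +oo] --> K <-> f t @[t --> +oo] --> (0 : 'M[R[i]]_d).
Proof.
have cK : (fun _ : R => K) t @[t --> +oo] --> K by exact: cvg_cst.
split=> [fK|f0].
  rewrite (_ : f = (fun t => f t + K - K)).
    have : f t + K - K @[t --> +oo] --> (K - K : 'M[R[i]]_d).
      exact: cvgB fK cK.
    by rewrite subrr.
  by apply/funext => t; rewrite addrK.
have : f t + K @[t --> +oo] --> (0 + K : 'M[R[i]]_d) by exact: cvgD f0 cK.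
by rewrite add0r.
Qed.

Lemma weakly_borel_summableP :
  weakly_borel_summable (fun k => X ^+ k) K <->
  mxborel (- (K *m X)) X t @[t --> +oo] --> (0 : 'M[R[i]]_d).
Proof.
rewrite -cvg_add_resolvent /weakly_borel_summable.
have -> : (fun x => (expR (- x))%:C *: weak_borel (fun k => X ^+ k) x) =
    (fun x => mxborel (- (K *m X)) X x + K).
  by apply/funext => x; exact: damped_weak_borel.
split=> [[_ wK]|wK]; first exact: wK.
split=> [x _|]; last exact: wK.
rewrite /conventionally_summable.
rewrite [series _](_ : _ = (fun n => (expR (- x))%:C *:
  series (weak_borel_term (fun k => X ^+ k) x) n)).
  apply/cvg_ex; eexists; apply: cvgZl_tmp; exact: cvg_weak_borel_series.
by apply/funext => n; rewrite /series /= scaler_sumr.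
Qed.

Lemma strongly_borel_summableP :
  strongly_borel_summable (fun k => X ^+ k) K <->
  mxborel (- K) X t @[t --> +oo] --> (0 : 'M[R[i]]_d).
Proof.
rewrite -cvg_add_resolvent /strongly_borel_summable /=.
have -> : (fun t => (expR (- t))%:C *: strong_borel (fun k => X ^+ k) t) =
    mxborel 1%:M X.
  by apply/funext => t; exact: damped_strong_borel.
have intE : \forall x \near +oo, mx_integral `[0, x] (mxborel 1%:M X) =
    mxborel (- K) X x + K.
  near=> x; apply: (mx_integral_damped_exp _).2.
  by near: x; apply: nbhs_pinfty_gt; exact: num_real.
split=> [[_ sK]|sK].
  by apply: cvg_trans sK; apply: near_eq_cvg; apply: filterS intE => x ->.
split=> [x x0|]; last first.
  by apply: cvg_trans sK; apply: near_eq_cvg; apply: filterS intE => x ->.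
split; last exact: (mx_integral_damped_exp x0).1.
by apply/cvg_ex; eexists; exact: cvg_strong_borel_series.
Unshelve. all: by end_near. Qed.

End BorelSums.

(** * The equivalences *)

Theorem proposition4p19 (R : realType) (d : nat) (X : 'M[R[i]]_d) :
  ((1%:M - X \in unitmx /\
    weakly_borel_summable (fun k : nat => X ^+ k) (invmx (1%:M - X)))
   <->
   (1%:M - X \in unitmx /\
    strongly_borel_summable (fun k : nat => X ^+ k) (invmx (1%:M - X))))
  /\
  ((1%:M - X \in unitmx /\
    strongly_borel_summable (fun k : nat => X ^+ k) (invmx (1%:M - X)))
   <->
   spectrum X `<=` [set z : R[i] | complex.Re z < 1]).
Proof.
have spec_unit : spectrum X `<=` [set z : R[i] | complex.Re z < 1] ->
    1%:M - X \in unitmx.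
  move=> sX; rewrite -row_free_unit -kermx_eq0; apply/negPn/negP => /rowV0Pn[v].
  move=> /sub_kermxP; rewrite mulmxBr mulmx1.
  move=> /eqP; rewrite subr_eq0 => /eqP vX v0.
  have : spectrum X 1 by apply/eigenvalueP; exists v; rewrite ?scale1r.
  by move=> /sX /=; rewrite ltxx.
have inv_neq0 (v : 'rV_d) : 1%:M - X \in unitmx -> v != 0 ->
    v *m invmx (1%:M - X) != 0.
  move=> X1; apply: contra => /eqP/(congr1 (mulmx^~ (1%:M - X))).
  by rewrite mulmxKV// mul0mx => ->.
have strong : (1%:M - X \in unitmx /\
    strongly_borel_summable (fun k : nat => X ^+ k) (invmx (1%:M - X))) <->
    spectrum X `<=` [set z : R[i] | complex.Re z < 1].
  split=> [[X1 /(strongly_borel_summableP X1) K0] a|sX].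
    move=> /eigenvalueP[v vX v0] /=.
    apply: (commuting_cvg0_eigenvalue vX _ _ K0).
      by rewrite mulNmx mulmxN resolvent_comm.
    by rewrite mulmxN oppr_eq0 inv_neq0.
  have X1 := spec_unit sX; split=> //; apply/strongly_borel_summableP => //.
  exact: spectrum_mxborel_cvg0.
have weak : (1%:M - X \in unitmx /\
    weakly_borel_summable (fun k : nat => X ^+ k) (invmx (1%:M - X))) <->
    spectrum X `<=` [set z : R[i] | complex.Re z < 1].
  split=> [[X1 /(weakly_borel_summableP X1) K0] a|sX].
    move=> /eigenvalueP[v vX v0] /=.
    have [->|a0] := eqVneq a 0; first exact: ltr01.
    apply: (commuting_cvg0_eigenvalue vX _ _ K0).
      by rewrite mulNmx mulmxN [X *m (_ *m _)]mulmxA -resolvent_comm.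
    rewrite mulmxN oppr_eq0 resolvent_comm// mulmxA vX -scalemxAl.
    by rewrite scaler_eq0 negb_or a0 inv_neq0.
  have X1 := spec_unit sX; split=> //; apply/weakly_borel_summableP => //.
  exact: spectrum_mxborel_cvg0.
by split=> //; rewrite weak strong.
Qed.
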